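(* Let $\lambda,\mu,\nu$ be partitions with at most two nonzero parts such that $|\lambda|+|\mu|+|\nu|\equiv0\pmod2$, and suppose $N_{k\mu,k\nu,k\lambda}>0$ for some integer $k\ge1$. Then: (i) $N_{\mu,\nu,\lambda}>0$; (ii) there exist partitions $\alpha,\beta,\gamma$ such that $c^{k\mu}_{k\alpha,k\beta}\,c^{k\nu}_{k\alpha,k\gamma}\,c^{k\lambda}_{k\beta,k\gamma}>0$.
   Context: For a partition $\lambda=(\lambda_1,\lambda_2,\ldots)$, $k\lambda=(k\lambda_1,k\lambda_2,\ldots)$ and $|\lambda|=\sum_i\lambda_i$. With $c_{\alpha,\beta}^{\mu}$ the Littlewood-Richardson coefficient ($s_\alpha s_\beta=\sum_\mu c_{\alpha,\beta}^\mu s_\mu$), the Newell-Littlewood number is $$N_{\mu,\nu,\lambda}=\sum_{\alpha,\beta,\gamma} c_{\alpha,\beta}^{\mu}c_{\alpha,\gamma}^{\nu}c_{\beta,\gamma}^{\lambda},$$ the sum over all triples of partitions (finitely many nonzero terms). *)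

(* Defs.v *)
From HB Require Import structures.
From mathcomp Require Import all_boot all_order all_algebra.
From mathcomp Require Import mpoly finmap.
From mathcomp Require Import boolp classical_sets cardinality fsbigop.
Set Implicit Arguments.
Unset Strict Implicit.
Unset Printing Implicit Defensive.
Import Order.TTheory GRing.Theory Num.Theory.
Local Open Scope ring_scope.

(* A partition is its list of nonzero parts, in weakly decreasing order, so
   that [size la] is the number of nonzero parts. *)
Record intpartn := IntPartn {
  parts :> seq nat;
  intpartnP : sorted geq parts && (0%N \notin parts) }.

HB.instance Definition _ := [isSub for parts].
HB.instance Definition _ := [Choice of intpartn by <:].

Definition weight (la : intpartn) : nat := sumn la.

(* The filter only matters for k = 0, where the result is the empty
   partition. *)
Definition scale_parts (k : nat) (la : intpartn) : seq nat :=
  [seq (k * x)%N | x <- la & (0 < k)%N].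

Lemma scale_partnP (k : nat) (la : intpartn) :
  sorted geq (scale_parts k la) && (0%N \notin scale_parts k la).
Proof.
rewrite /scale_parts; have /andP[la_sorted la_pos] := intpartnP la.
case: k => [|k]; first by rewrite filter_pred0.
rewrite filter_predT; apply/andP; split.
  by apply: homo_sorted la_sorted => x y /=; rewrite leq_pmul2l.
by apply: contra la_pos => /mapP[[|x] // x_la _].
Qed.

Definition scale (k : nat) (la : intpartn) : intpartn := IntPartn (scale_partnP k la).

(* The alternant a_{la + delta} = det (x_i ^ (la_j + n - j)) in n variables;
   the exponent is written for 0-based j, and missing parts of la are 0. *)
Definition alternant (n : nat) (la : seq nat) : {mpoly int[n]} :=
  \det (\matrix_(i < n, j < n) ('X_i ^+ (nth 0%N la j + (n - j.+1)))).

(* The Schur polynomial s_la(x_1, ..., x_n) = a_{la + delta} / a_delta, as an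
   element of the fraction field of Z[x_1, ..., x_n]; it is 0 when la has more
   than n parts. *)
Definition schur (n : nat) (la : intpartn) : {fraction {mpoly int[n]}} :=
  if (size la <= n)%N then
    tofrac (alternant n la) / tofrac (alternant n [::])
  else 0.

(* [c] is the family of coefficients of s_al * s_be in the basis of Schur
   functions.  An identity between symmetric functions is an identity in every
   finite number of variables. *)
Definition schur_expansion (al be : intpartn) (c : intpartn -> int) : Prop :=
  finite_set [set mu | c mu != 0] /\
  forall n : nat, schur n al * schur n be =
                  \sum_(mu \in [set: intpartn]) schur n mu *~ c mu.

(* Exactly one family satisfies [schur_expansion al be], because the Schur
   functions form a Z-basis of the ring of symmetric functions. *)
Definition LRcoef (al be mu : intpartn) : int :=
  xget (fun=> 0) [set c | schur_expansion al be c] mu.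

(* [\sum_(t \in A)] is the sum over the support of the summand in A, which is
   finite here: a nonzero term forces |al| + |be| = |mu| and
   |al| + |ga| = |nu|. *)
Definition NLnumber (mu nu la : intpartn) : int :=
  \sum_(t \in [set: intpartn * intpartn * intpartn])
    (let: (al, be, ga) := t in
     LRcoef al be mu * LRcoef al ga nu * LRcoef be ga la).

(* Main.v *)
Require Import Defs.
From mathcomp Require Import all_boot all_order all_algebra fingroup perm zify ring.
From mathcomp Require Import mpoly.
From mathcomp Require Import boolp classical_sets cardinality fsbigop.
Set Implicit Arguments.
Unset Strict Implicit.
Unset Printing Implicit Defensive.
Import Order.TTheory GRing.Theory Num.Theory.
Local Open Scope ring_scope.

Implicit Types la mu nu al be ga : intpartn.

(** The heart of the matter is that for partitions with at most two parts
    everything reduces to linear inequalities which survive division by [k]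
    with rounding.

    If [mu] has at most two parts, then [c_{al,be}^mu] is 0 unless [al] and
    [be] have at most two parts, and it can be computed in two variables, where
    the product of two Schur polynomials is given by the Clebsch-Gordan formula:
    [c_{al,be}^mu] is 1 when [|al| + |be| = |mu|],
    [al_2 + be_2 <= mu_2], [mu_2 <= al_2 + be_1] and [mu_2 <= al_1 + be_2], and
    it is 0 otherwise ([LRcoef_two_row]).

    A nonzero term of [N_{k mu, k nu, k la}] is given by [al], [be], [ga], whose
    weights are determined by those of [k mu], [k nu], [k la]; because
    [|la| + |mu| + |nu|] is even, they are multiples [k A], [k B], [k C] of
    natural numbers.  With the weights fixed, the second parts [p], [q], [r] of
    [al], [be], [ga] are the only unknowns.  They are only subject to upper
    bounds on the sums [p + q], [p + r], [q + r], bounds on the differences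
    [p - q], [p - r], [q - r], the conditions [2 p <= k A], [2 q <= k B],
    [2 r <= k C], and nonnegativity, and the bounds on sums and differences are
    multiples of [k].  Hence the integer parts of [p / k], [q / k], [r / k]
    satisfy the same inequalities with the bounds divided by [k]
    ([two_row_NL_shrink]): this gives a nonzero term of [N_{mu, nu, la}], and
    its dilation by [k] is the triple required in (ii).

    The coefficients are defined by an expansion valid in every number of
    variables, so the computation in two variables only makes sense once such an
    expansion is known to exist ([exists_schur_expansion]).  The Pieri rule for
    the elementary symmetric polynomials [e_r] follows from the alternants:
    multiplying an alternant by [e_r] adds 1 to [r] of its exponents in all
    possible ways ([mesym_alt], [mesym_schur]).  It shows that multiplication by
    [e_r] preserves the integer combinations of Schur functions whose
    coefficients do not depend on the number of variables.  So does
    multiplication by any [s_la], by induction: if [la'] is [la] without its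
    first column, of length [r], then [s_la] is [e_r * s_la'] minus Schur
    functions of the same weight as [la] with more parts
    ([expandable_schurM]). *)

(** * Partitions *)

Lemma geq_total : total geq. Proof. by move=> x y; lia. Qed.
Lemma geq_trans : transitive geq. Proof. by move=> x y z /=; lia. Qed.
Lemma geq_refl : reflexive geq. Proof. by move=> x /=. Qed.

Lemma sorted_geq_nth (s : seq nat) i j :
  sorted geq s -> (i <= j)%N -> (nth 0%N s j <= nth 0%N s i)%N.
Proof.
move=> s_sorted le_ij; have [lt_js|le_sj] := ltnP j (size s); last first.
  by rewrite (nth_default _ le_sj).
by apply: (sorted_leq_nth geq_trans geq_refl 0%N s_sorted) => //=;
  rewrite inE //; lia.
Qed.

Lemma partition_ofP (s : seq nat) :
  let t := sort geq [seq x <- s | x != 0%N] in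
  sorted geq t && (0%N \notin t).
Proof. by rewrite /= (sort_sorted geq_total) mem_sort mem_filter eqxx. Qed.

(** The partition whose nonzero parts are the nonzero entries of [s], which may
    come in any order. *)
Definition partition_of (s : seq nat) : intpartn := IntPartn (partition_ofP s).

Lemma nth_partition_of (s : seq nat) i :
  sorted geq s -> nth 0%N (partition_of s) i = nth 0%N s i.
Proof.
move=> s_sorted /=; rewrite (sorted_sort geq_trans); last first.
  exact: (sorted_filter geq_trans).
elim: s i s_sorted => [|x s IHs] i //= xs_sorted.
have {IHs} := IHs _ (path_sorted xs_sorted).
case: x xs_sorted => [|x] xs_sorted IHs /=; last by case: i.
have s0 j : nth 0%N s j = 0%N.
  by have /= := @sorted_geq_nth (0%N :: s) _ _ xs_sorted (leq0n j.+1); lia.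
by rewrite IHs s0; case: i => //= i; rewrite s0.
Qed.

Lemma part_mono (la : intpartn) i j :
  (i <= j)%N -> (nth 0%N la j <= nth 0%N la i)%N.
Proof. by apply: sorted_geq_nth; case/andP: (intpartnP la). Qed.

Lemma part_gt0 (la : intpartn) i : (0 < nth 0%N la i)%N = (i < size la)%N.
Proof.
have [lt_i|le_i] := ltnP i (size la); last by rewrite nth_default.
rewrite lt0n; apply: contraTneq (mem_nth 0%N lt_i) => ->.
by case/andP: (intpartnP la).
Qed.

Lemma part_eq0 (la : intpartn) i : (size la <= i)%N -> nth 0%N la i = 0%N.
Proof. exact: nth_default. Qed.

Lemma intpartn_ext (la mu : intpartn) :
  (forall i, nth 0%N la i = nth 0%N mu i) -> la = mu.
Proof.
move=> eq_parts.
have lt_size i : (i < size la)%N = (i < size mu)%N.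
  by rewrite -!part_gt0 eq_parts.
apply: val_inj; apply: (@eq_from_nth _ 0%N) => [|i _]; last exact: eq_parts.
by have := lt_size (size la); have := lt_size (size mu); rewrite /=; lia.
Qed.

Lemma weightE n (la : intpartn) :
  (size la <= n)%N -> weight la = (\sum_(i < n) nth 0%N la i)%N.
Proof.
move=> le_la_n; rewrite /weight sumnE (big_nth 0%N) big_mkord.
rewrite (big_ord_widen n (fun i => nth 0%N la i) le_la_n).
rewrite [RHS](bigID (fun i : 'I_n => (i < size la)%N)) /= [X in (_ + X)%N]big1
  ?addn0 //.
by move=> i; rewrite -leqNgt => /part_eq0.
Qed.

Lemma weight2E la : (size la <= 2)%N ->
  weight la = (nth 0%N la 0 + nth 0%N la 1)%N.
Proof. by move=> le_la; rewrite (weightE le_la) !big_ord_recr big_ord0. Qed.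

Lemma two_row_ext la mu : (size la <= 2)%N -> (size mu <= 2)%N ->
  nth 0%N la 0 = nth 0%N mu 0 -> nth 0%N la 1 = nth 0%N mu 1 -> la = mu.
Proof.
move=> le_la le_mu eq0 eq1; apply: intpartn_ext => -[|[|i]] //.
by rewrite !part_eq0 // (leq_trans _ (leq_addr i 2)) // addnC.
Qed.

Lemma size_le_weight (la : intpartn) : (size la <= weight la)%N.
Proof.
rewrite (weightE (leqnn _)) -[X in (X <= _)%N](card_ord (size la)) -sum1_card.
by apply: leq_sum => i _; rewrite part_gt0.
Qed.

Lemma size_partition_of n (s : seq nat) :
  (size s <= n)%N -> (size (partition_of s) <= n)%N.
Proof.
by move=> le_s; rewrite size_sort (leq_trans _ le_s) // size_filter count_size.
Qed.

(** * The Pieri rule for elementary symmetric polynomials *)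

(** The alternant with exponents [l 0, ..., l (n - 1)], in no particular
    order. *)
Definition alt n (l : 'I_n -> nat) : {mpoly int[n]} :=
  \det (\matrix_(i < n, j < n) ('X_i ^+ l j)).

Lemma altE n (l : 'I_n -> nat) :
  alt l = \sum_(s : 'S_n) (-1) ^+ s * \prod_(i < n) 'X_i ^+ l (s i).
Proof.
apply: eq_bigr => s _; congr (_ * _); apply: eq_bigr => i _.
by rewrite mxE.
Qed.

Lemma eq_alt n (l l' : 'I_n -> nat) : l =1 l' -> alt l = alt l'.
Proof.
by move=> eq_l; rewrite !altE; apply: eq_bigr => s _; congr (_ * _);
  apply: eq_bigr => i _; rewrite eq_l.
Qed.

Lemma alt_eq0 n (l : 'I_n -> nat) i j : i != j -> l i = l j -> alt l = 0.
Proof.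
move=> neq_ij eq_l; rewrite /alt -det_tr.
by apply: (determinant_alternate neq_ij) => m; rewrite !mxE eq_l.
Qed.

Lemma alternantE n (la : seq nat) :
  alternant n la = alt (fun j : 'I_n => nth 0%N la j + (n - j.+1))%N.
Proof. by []. Qed.

(** In the term of a permutation [s], the variables of [e_r] indexed by [T]
    raise the exponents indexed by [s @: T]; hence the reindexing by [s]. *)
Lemma mesym_alt n r (l : 'I_n -> nat) :
  mesym n int r * alt l =
  \sum_(T : {set 'I_n} | #|T| == r) alt (fun j => l j + (j \in T))%N.
Proof.
rewrite altE mulr_sumr; under [RHS]eq_bigr do rewrite altE.
rewrite exchange_big /=; apply: eq_bigr => s _.
rewrite -mulr_sumr mulrCA; congr (_ * _).
rewrite mulr_suml [RHS](reindex_inj (imset_inj (@perm_inj _ s))) /=.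
apply: eq_big => [T|T _]; first by rewrite card_imset //; exact: perm_inj.
rewrite [X in X * _]big_mkcond -big_split /=; apply: eq_bigr => i _.
rewrite exprD mulrC (mem_imset _ _ perm_inj).
by case: (i \in T); rewrite ?expr1 ?expr0.
Qed.

(** [la] with one box added to each row in [T], as a sequence of length [n];
    it need not be weakly decreasing. *)
Definition add_rows n (la : intpartn) (T : {set 'I_n}) : seq nat :=
  [seq (nth 0%N la (val j) + (j \in T))%N | j <- enum 'I_n].

Lemma size_add_rows n la (T : {set 'I_n}) : size (add_rows la T) = n.
Proof. by rewrite size_map size_enum_ord. Qed.

Lemma nth_add_rows n (la : intpartn) (T : {set 'I_n}) (j : 'I_n) :
  nth 0%N (add_rows la T) j = (nth 0%N la j + (j \in T))%N.
Proof. by rewrite (nth_map j) ?size_enum_ord // nth_ord_enum. Qed.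

(** If adding the boxes breaks monotonicity, then it does so at two consecutive
    rows of equal length, whose exponents become equal. *)
Lemma alt_add_rows n (la : intpartn) (T : {set 'I_n}) :
  alt (fun j : 'I_n => nth 0%N la j + (n - j.+1) + (j \in T))%N =
  if sorted geq (add_rows la T) then
    alternant n (partition_of (add_rows la T)) else 0.
Proof.
case: ifPn => [T_sorted|].
  rewrite alternantE; apply: eq_alt => j.
  by rewrite nth_partition_of // nth_add_rows; lia.
move=> not_sorted; have [i [lt_i]] : exists i : nat, (i.+1 < n)%N /\
    (nth 0%N (add_rows la T) i < nth 0%N (add_rows la T) i.+1)%N.
  apply: contrapT => no_ascent; case/negP: not_sorted; apply/(sortedP 0%N) => i.
  rewrite size_add_rows => lt_i; rewrite /= leqNgt; apply/negP => ascent.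
  by apply: no_ascent; exists i.
have lt_i' := ltnW lt_i.
have := nth_add_rows la T (Ordinal lt_i); have := nth_add_rows la T (Ordinal lt_i').
move=> /= -> ->; have := part_mono la (leqnSn i).
case iS_T: (Ordinal lt_i \in T); case i_T: (Ordinal lt_i' \in T); try lia.
move=> le_la lt_la; apply: (@alt_eq0 _ _ (Ordinal lt_i) (Ordinal lt_i')).
  by rewrite -val_eqE /=; lia.
by rewrite iS_T i_T /=; lia.
Qed.

(** The partitions of length at most [n] obtained from [la] by adding a
    vertical strip of [r] boxes. *)
Definition vstrips n (la : intpartn) r : seq intpartn :=
  [seq partition_of (add_rows la T) |
    T : {set 'I_n} <- enum {set 'I_n} & (#|T| == r) && sorted geq (add_rows la T)].

(** [mu / la] is a vertical strip of [r] boxes. *)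
Definition is_vstrip (la mu : intpartn) r : Prop :=
  (forall i, nth 0%N la i <= nth 0%N mu i <= (nth 0%N la i).+1)%N /\
  weight mu = (weight la + r)%N.

Lemma mem_vstrips n (la mu : intpartn) r : (size la <= n)%N ->
  mu \in vstrips n la r <-> (size mu <= n)%N /\ is_vstrip la mu r.
Proof.
move=> le_la_n; split.
  case/mapP=> T; rewrite mem_filter => /andP[/andP[/eqP card_T T_sorted] _] ->.
  have le_mu_n : (size (partition_of (add_rows la T)) <= n)%N.
    by apply: size_partition_of; rewrite size_add_rows.
  split=> //; split=> [i|].
    rewrite nth_partition_of //; have [lt_i|le_n_i] := ltnP i n.
      by rewrite (nth_add_rows la T (Ordinal lt_i)); case: (_ \in T) => /=; lia.
    by rewrite !nth_default ?size_add_rows //; lia.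
  rewrite (weightE le_mu_n) (weightE le_la_n) -card_T -sum1_card.
  rewrite [X in (_ + X)%N]big_mkcond -big_split /=; apply: eq_bigr => j _.
  by rewrite nth_partition_of // nth_add_rows; case: (j \in T).
case=> le_mu_n [strip weight_mu].
pose T := [set j : 'I_n | nth 0%N mu j == (nth 0%N la j).+1].
have nthT (j : 'I_n) : nth 0%N mu j = (nth 0%N la j + (j \in T))%N.
  by rewrite inE; have := strip j; case: eqP => /=; lia.
have nthT' i : nth 0%N (add_rows la T) i = nth 0%N mu i.
  have [lt_i|le_n_i] := ltnP i n.
    by rewrite (nth_add_rows la T (Ordinal lt_i)) -nthT.
  by rewrite !nth_default ?size_add_rows //; lia.
have T_sorted : sorted geq (add_rows la T).
  by apply/(sortedP 0%N) => i _; rewrite !nthT' /=; apply: part_mono.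
apply/mapP; exists T; last by apply: intpartn_ext => i; rewrite nth_partition_of.
rewrite mem_filter T_sorted mem_enum andbT andbT; apply/eqP.
have := weight_mu; rewrite (weightE le_mu_n) (weightE le_la_n).
rewrite (eq_bigr _ (fun j _ => nthT j)).
rewrite big_split /= => /addnI <-; rewrite -sum1_card big_mkcond /=.
by apply: eq_bigr => j _; case: (j \in T).
Qed.

Lemma uniq_vstrips n la r : uniq (vstrips n la r).
Proof.
rewrite map_inj_in_uniq => [|T U]; first exact/filter_uniq/enum_uniq.
rewrite !mem_filter => /andP[/andP[_ T_sorted] _] /andP[/andP[_ U_sorted] _].
move=> eqTU; apply/setP => j.
have := nth_add_rows la T j; rewrite -nth_partition_of // eqTU.
rewrite nth_partition_of // nth_add_rows => /addnI.
by case: (j \in T); case: (j \in U).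
Qed.

Lemma mesym_alternant n r (la : intpartn) :
  mesym n int r * alternant n la = \sum_(mu <- vstrips n la r) alternant n mu.
Proof.
rewrite alternantE mesym_alt big_map big_filter_cond.
rewrite (eq_bigr _ (fun T _ => alt_add_rows la T)) -big_mkcondr.
rewrite big_enum_cond /=.
by apply: eq_bigl => T; rewrite andbT.
Qed.

(** The Pieri rule with a list of partitions that does not depend on [n]: a
    partition of weight [weight la + r] has at most that many parts. *)
Lemma mesym_schur n r (la : intpartn) :
  tofrac (mesym n int r) * schur n la =
  \sum_(mu <- vstrips (weight la + r) la r) schur n mu.
Proof.
have le_la_wr : (size la <= weight la + r)%N.
  by apply: leq_trans (size_le_weight la) _; rewrite leq_addr.
have size_strip mu : mu \in vstrips (weight la + r) la r -> (size la <= size mu)%N.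
  move=> /(mem_vstrips _ _ le_la_wr)[_ [strip _]]; case: leqP => // lt_mu_la.
  have := strip (size mu); rewrite (part_eq0 (leqnn (size mu))).
  by have := part_gt0 la (size mu); rewrite lt_mu_la; lia.
have [le_la_n|lt_n_la] := leqP (size la) n; last first.
  rewrite /schur leqNgt lt_n_la mulr0 big_seq big1 // => mu /size_strip le_la_mu.
  by rewrite leqNgt (leq_trans lt_n_la).
rewrite {1}/schur le_la_n mulrA -tofracM mesym_alternant rmorph_sum /= mulr_suml.
have perm_strips : perm_eq (vstrips n la r)
    [seq mu : intpartn <- vstrips (weight la + r) la r | (size mu <= n)%N].
  apply: uniq_perm => [||mu]; rewrite ?filter_uniq ?uniq_vstrips //.
  rewrite mem_filter; apply/idP/andP.
    case/(mem_vstrips _ _ le_la_n)=> le_mu_n strip; split=> //.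
    apply/(mem_vstrips _ _ le_la_wr); split=> //.
    by case: strip => _ <-; apply: size_le_weight.
  case=> le_mu_n /(mem_vstrips _ _ le_la_wr)[_ strip].
  by apply/(mem_vstrips _ _ le_la_n).
rewrite (perm_big _ perm_strips) big_filter big_mkcond.
by apply: eq_bigr => mu _; rewrite /schur; case: leqP.
Qed.

(** * Existence of Littlewood-Richardson expansions *)

(** A family [f], one element for each number [n] of variables, is expandable
    when it is an integer combination of Schur functions with coefficients that
    do not depend on [n]; the combination is given as a list of terms. *)
Definition expandable (f : forall n, {fraction {mpoly int[n]}}) : Prop :=
  exists s : seq (int * intpartn),
    forall n, f n = \sum_(p <- s) schur n p.2 *~ p.1.

Lemma expandable_ext f g :
  (forall n, f n = g n) -> expandable f -> expandable g.
Proof. by move=> eq_fg [s fE]; exists s => n; rewrite -eq_fg. Qed.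

Lemma expandable_schur la : expandable (fun n => schur n la).
Proof. by exists [:: (1, la)] => n; rewrite big_seq1. Qed.

Lemma expandableMz f (z : int) :
  expandable f -> expandable (fun n => f n *~ z).
Proof.
case=> s fE; exists [seq (p.1 * z, p.2) | p <- s] => n.
rewrite fE big_map mulrz_suml.
by apply: eq_bigr => p _; rewrite mulrzA.
Qed.

Lemma expandableD f g :
  expandable f -> expandable g -> expandable (fun n => f n + g n).
Proof.
by case=> s fE [t gE]; exists (s ++ t) => n; rewrite big_cat fE gE.
Qed.

Lemma expandableB f g :
  expandable f -> expandable g -> expandable (fun n => f n - g n).
Proof.
move=> f_exp g_exp; have := expandableD f_exp (expandableMz (-1) g_exp).
by apply: expandable_ext => n; rewrite mulrNz.
Qed.

Lemma expandable_sum (I : eqType) (r : seq I) (P : pred I)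
    (F : I -> forall n, {fraction {mpoly int[n]}}) :
  (forall i, i \in r -> P i -> expandable (F i)) ->
  expandable (fun n => \sum_(i <- r | P i) F i n).
Proof.
elim: r => [|i r IHr] F_exp; first by exists [::] => n; rewrite !big_nil.
have {}IHr := IHr (fun j rj => F_exp j (mem_behead (s := i :: r) rj)).
case Pi: (P i); last first.
  by apply: expandable_ext IHr => n; rewrite big_cons Pi.
have := expandableD (F_exp i (mem_head _ _) Pi) IHr.
by apply: expandable_ext => n; rewrite big_cons Pi.
Qed.

Lemma expandable_mesym f r :
  expandable f -> expandable (fun n => tofrac (mesym n int r) * f n).
Proof.
case=> s fE; pose g (p : int * intpartn) n :=
  (\sum_(mu <- vstrips (weight p.2 + r) p.2 r) schur n mu) *~ p.1.
have g_exp p : expandable (g p).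
  by apply: expandableMz; apply: expandable_sum => mu _ _; apply: expandable_schur.
have := @expandable_sum _ s xpredT g (fun p _ _ => g_exp p).
apply: expandable_ext => n; rewrite fE mulr_sumr.
by apply: eq_bigr => p _; rewrite /g -mesym_schur -mulrzAr.
Qed.

(** [la] with its first column removed. *)
Definition behead_col (la : intpartn) : intpartn :=
  partition_of [seq x.-1 | x <- la].

Lemma nth_behead_col la i :
  nth 0%N (behead_col la) i = (nth 0%N la i).-1.
Proof.
have nth_pred j : nth 0%N [seq x.-1 | x <- parts la] j = (nth 0%N la j).-1.
  have [lt_j|le_j] := ltnP j (size la); first by rewrite (nth_map 0%N).
  by rewrite !nth_default ?size_map.
rewrite nth_partition_of //; apply/(sortedP 0%N) => j _.
by rewrite !nth_pred /=; have := part_mono la (leqnSn j); lia.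
Qed.

Lemma size_behead_col la : (size (behead_col la) <= size la)%N.
Proof. by apply: size_partition_of; rewrite size_map. Qed.

Lemma is_vstrip_behead_col la : is_vstrip (behead_col la) la (size la).
Proof.
split=> [i|]; first by rewrite nth_behead_col; lia.
rewrite (weightE (leqnn (size la))) (weightE (size_behead_col la)).
rewrite -[X in (_ + X)%N](card_ord (size la)) -sum1_card -big_split /=.
apply: eq_bigr => i _; rewrite nth_behead_col addn1 prednK //.
by rewrite part_gt0.
Qed.

(** The full column is the only vertical strip of [size la] boxes that fits in
    the first [size la] rows. *)
Lemma vstrip_behead_col_max la mu :
  is_vstrip (behead_col la) mu (size la) -> (size mu <= size la)%N -> mu = la.
Proof.
move=> [strip weight_mu] le_mu; have [_ weight_la] := is_vstrip_behead_col la.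
have le_mu_la (i : 'I_(size la)) : (nth 0%N mu i <= nth 0%N la i)%N.
  by have := strip i; have := ltn_ord i; rewrite -part_gt0 nth_behead_col; lia.
apply: intpartn_ext => i; have [lt_i|le_i] := ltnP i (size la); last first.
  by rewrite !part_eq0 // (leq_trans le_mu).
have := eqxx (weight mu); rewrite {2}weight_mu -weight_la.
rewrite (weightE le_mu) (weightE (leqnn (size la))).
have /leqif_sum -> : forall j : 'I_(size la), true ->
    (nth 0%N mu j <= nth 0%N la j ?= iff (nth 0%N mu j == nth 0%N la j))%N.
  by move=> j _; split.
by move/forallP=> /(_ (Ordinal lt_i)) /eqP.
Qed.

(** Holds even if the alternant of the empty partition were zero, since [x / 0]
    would then be zero. *)
Lemma schurM_nil n (la mu : intpartn) :
  size mu = 0%N -> schur n mu * schur n la = schur n la.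
Proof.
move=> /size0nil mu_nil; rewrite /schur mu_nil /=.
case: ifP => _; last by rewrite mulr0.
have [->|nz] := eqVneq (tofrac (alternant n [::])) 0; first by rewrite invr0 !mulr0.
by rewrite divff // mul1r.
Qed.

(** Induction on the weight of [la], then downwards on its length. *)
Lemma expandable_schurM la f :
  expandable f -> expandable (fun n => schur n la * f n).
Proof.
have [m] := ubnP (weight la); elim: m la f => // m IHm la f.
have [d] := ubnP (weight la - size la); elim: d la f => // d IHd la f lt_d lt_m f_exp.
have [la0|la_gt0] := posnP (size la).
  case: f_exp => s fE; exists s => n; rewrite fE mulr_sumr.
  by apply: eq_bigr => p _; rewrite mulrzAr schurM_nil.
pose V := vstrips (weight (behead_col la) + size la) (behead_col la) (size la).
have [strip weight_la] := is_vstrip_behead_col la.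
have le_la' : (size (behead_col la) <= weight (behead_col la) + size la)%N.
  by apply: leq_trans (size_behead_col la) _; rewrite leq_addl.
have la_V : la \in V.
  apply/(mem_vstrips _ _ le_la'); split; last by split.
  by rewrite -weight_la size_le_weight.
have lower_exp mu : mu \in V -> mu != la -> expandable (fun n => schur n mu * f n).
  move=> /(mem_vstrips _ _ le_la')[_ mu_strip] neq_mu.
  have lt_la_mu : (size la < size mu)%N.
    by rewrite ltnNge; apply: contra_neqN neq_mu; apply: vstrip_behead_col_max.
  case: mu_strip => _; rewrite -weight_la => weight_mu.
  by apply: (IHd mu f) => //; have := size_le_weight mu; lia.
have col_exp : expandable (fun n => schur n (behead_col la) * f n).
  by apply: (IHm (behead_col la) f) => //; lia.
have := expandableB (expandable_mesym (size la) col_exp)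
  (@expandable_sum _ V (predC1 la) _ lower_exp).
apply: expandable_ext => n; rewrite mulrA mesym_schur -/V.
rewrite (bigD1_seq la la_V (uniq_vstrips _ _ _)) /= mulrDl mulr_suml.
by rewrite addrK.
Qed.

Lemma exists_schur_expansion al be : exists c, schur_expansion al be c.
Proof.
have [s sE] := expandable_schurM al (expandable_schur be).
pose c mu := \sum_(p <- s | p.2 == mu) p.1.
have c_supp mu : mu \notin undup [seq p.2 | p <- s] -> c mu = 0.
  rewrite mem_undup => s'mu; rewrite /c big_seq_cond big1 // => p /andP[s_p /eqP p_mu].
  by case/negP: s'mu; rewrite -p_mu map_f.
exists c; split=> [|n].
  apply: (@sub_finite_set _ _ [set` undup [seq p.2 | p <- s]]); last exact: finite_seq.
  by move=> mu /=; apply: contraNT => /c_supp ->.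
rewrite sE [RHS](@fsbigE _ _ _ _ _ (undup [seq p.2 | p <- s])) ?undup_uniq //;
  last by move=> mu _ /c_supp ->; rewrite mulr0z.
rewrite [RHS]big_mkcond /=; under [RHS]eq_bigr => mu _ do rewrite in_setT mulrz_sumr.
rewrite [RHS](exchange_big_dep xpredT) //= big_seq [RHS]big_seq.
apply: eq_bigr => p s_p.
rewrite [RHS]big_mkcond (bigD1_seq p.2) ?undup_uniq ?mem_undup ?map_f //= eqxx.
by rewrite big1 ?addr0 // => mu /negPf; rewrite eq_sym => ->.
Qed.

(** * Littlewood-Richardson coefficients of two-row partitions *)

Local Notation x2 := ('X_(@ord0 1) : {mpoly int[2]}).
Local Notation y2 := ('X_(@ord_max 1) : {mpoly int[2]}).

(** The alternant of the partition [(p, q)] in two variables. *)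
Definition alt2 p q : {mpoly int[2]} :=
  x2 ^+ p.+1 * y2 ^+ q - x2 ^+ q * y2 ^+ p.+1.

Lemma alternant2E (s : seq nat) :
  alternant 2 s = alt2 (nth 0%N s 0) (nth 0%N s 1).
Proof.
rewrite /alternant (expand_det_row _ ord0) !big_ord_recl big_ord0 /cofactor.
rewrite !det_mx11 !mxE /= /alt2.
have -> : lift ord0 0 = ord_max :> 'I_2 by apply: val_inj.
rewrite /bump /= !addn0 !addn1 expr0 expr1; ring.
Qed.

Lemma mcoeff_mon2 (a b c d : nat) :
  (x2 ^+ a * y2 ^+ b)@_(U_(ord0) *+ c + U_(ord_max) *+ d)%MM =
  ((a == c) && (b == d))%:R.
Proof.
rewrite !mpolyXn -mpolyXD mcoeffX; congr (nat_of_bool _)%:R.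
apply/eqP/andP => [/mnmP eq_m|[/eqP-> /eqP->] //].
have := eq_m ord0; have := eq_m ord_max.
by rewrite !mnmDE !mulmnE !mnm1E /=; lia.
Qed.

(** The exponent [la + delta] of the leading monomial of the alternant. *)
Definition lead2 (la : intpartn) : 'X_{1..2} :=
  (U_(ord0) *+ (nth 0%N la 0).+1 + U_(ord_max) *+ nth 0%N la 1)%MM.

Lemma mcoeff_alternant2 (la mu : intpartn) :
  (size la <= 2)%N -> (size mu <= 2)%N ->
  (alternant 2 la)@_(lead2 mu) = (la == mu)%:R.
Proof.
move=> le_la le_mu; rewrite alternant2E mcoeffB !mcoeff_mon2.
have := part_mono mu (leqnSn 0); have := part_mono la (leqnSn 0).
have -> : (la == mu) =
    (nth 0%N la 0 == nth 0%N mu 0) && (nth 0%N la 1 == nth 0%N mu 1).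
  apply/eqP/andP => [-> //|[/eqP eq0 /eqP eq1]]; exact: two_row_ext.
move=> le1 le2.
have -> : (nth 0%N la 1 == (nth 0%N mu 0).+1) && ((nth 0%N la 0).+1 == nth 0%N mu 1)
   = false by lia.
by rewrite subr0 eqSS.
Qed.

Lemma alternant2_neq0 : alternant 2 [::] != 0.
Proof.
have := @mcoeff_alternant2 (partition_of [::]) (partition_of [::]) isT isT.
by rewrite eqxx; apply: contra_eq_neq => /= ->; rewrite mcoeff0 eq_sym oner_eq0.
Qed.

(** Schur polynomials in two variables are linearly independent. *)
Lemma coef_schur2 (c : intpartn -> int) (P : {mpoly int[2]})
    (mu : intpartn) :
  finite_set [set nu | c nu != 0]%classic ->
  tofrac P / tofrac (alternant 2 [::]) =
    \sum_(nu \in [set: intpartn]) schur 2 nu *~ c nu ->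
  (size mu <= 2)%N -> c mu = P@_(lead2 mu).
Proof.
case/finite_seqP=> s suppE; rewrite (@fsbigE _ _ _ _ _ (undup s)) ?undup_uniq //;
  last first.
  move=> nu _; rewrite mem_undup => s'nu.
  have -> : c nu = 0; last by rewrite mulr0z.
  apply: contraNeq s'nu => c_nu.
  have : ([set nu | c nu != 0]%classic) nu by [].
  by rewrite suppE.
have -> : \sum_(nu <- undup s | nu \in [set: intpartn]%classic) schur 2 nu *~ c nu
    = tofrac (\sum_(nu <- undup s | (size nu <= 2)%N) alternant 2 nu *~ c nu)
      / tofrac (alternant 2 [::]).
  rewrite rmorph_sum mulr_suml /= [RHS]big_mkcond [LHS]big_mkcond.
  apply: eq_bigr => nu _; rewrite in_setT /schur.
  by case: ifP => _; rewrite ?mul0rz // raddfMz mulrzAl.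
move/(mulIf (invr_neq0 _)); rewrite tofrac_eq0 alternant2_neq0.
move=> /(_ isT) /eqP; rewrite tofrac_eq => /eqP -> le_mu.
rewrite raddf_sum /=.
have coefE (nu : intpartn) : (size nu <= 2)%N ->
    (alternant 2 nu *~ c nu)@_(lead2 mu) = if nu == mu then c mu else 0.
  move=> le_nu; rewrite raddfMz /= mcoeff_alternant2 //.
  by case: eqP => [->|_]; rewrite ?mul0rz // intz.
rewrite (eq_bigr _ coefE) -big_mkcondr /=.
have [c_mu|c_mu] := eqVneq (c mu) 0.
  by rewrite big1 // => nu; rewrite c_mu.
have s_mu : mu \in undup s.
  by rewrite mem_undup; have : ([set nu | c nu != 0]%classic) mu by []; rewrite suppE.
rewrite big_mkcond (bigD1_seq mu) ?undup_uniq //= le_mu eqxx /=.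
by rewrite big1 ?addr0 // => nu /negPf ->; rewrite andbF.
Qed.

(** The Clebsch-Gordan formula, obtained by writing the Schur polynomial of
    [(q1, q2)] as the sum of the monomials [x ^ (q1 - j) * y ^ (q2 + j)].  When
    [p1 - p2 < q1 - q2], some of the terms on the right belong to pairs that are
    not weakly decreasing. *)
Lemma alt2M p1 p2 q1 q2 : (q2 <= q1)%N ->
  alt2 p1 p2 * alt2 q1 q2 =
  alt2 0 0 * \sum_(j < (q1 - q2).+1) alt2 (p1 + q1 - j) (p2 + q2 + j).
Proof.
move=> le_q.
pose h := \sum_(j < (q1 - q2).+1) x2 ^+ (q1 - j) * y2 ^+ (q2 + j).
have qE : alt2 q1 q2 = alt2 0 0 * h.
  rewrite /alt2 !expr0 !mulr1 !expr1.
  rewrite mul1r.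
  have -> : h = (x2 * y2) ^+ q2 * \sum_(j < (q1 - q2).+1) x2 ^+ (q1 - q2 - j) * y2 ^+ j.
    rewrite mulr_sumr; apply: eq_bigr => j _.
    have -> : (q1 - j = q2 + (q1 - q2 - j))%N by have := ltn_ord j; lia.
    by rewrite exprMn !exprD; ring.
  have := subrXX x2 y2 (q1 - q2).+1; rewrite /= => eqX.
  rewrite mulrCA -eqX.
  have -> : q1.+1 = (q2 + (q1 - q2).+1)%N by lia.
  by rewrite !exprD exprMn; ring.
rewrite qE mulrCA; congr (_ * _).
(* reversing the order of the second sum makes the terms match *)
rewrite /h {1}/alt2 mulrBl !mulr_sumr [X in _ - X](reindex_inj rev_ord_inj) /=.
rewrite -sumrB; apply: eq_bigr => j _; have lt_j := ltn_ord j.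
rewrite [X in X - _]mulrACA [X in _ - X]mulrACA -!exprD.
by congr (_ ^+ _ * _ ^+ _ - _ ^+ _ * _ ^+ _); lia.
Qed.

(** The Clebsch-Gordan condition for [s_mu] to occur in [s_al * s_be], where all
    three partitions have at most two parts. *)
Definition two_row_LR (al be mu : intpartn) : bool :=
  [&& (size al <= 2)%N, (size be <= 2)%N, (size mu <= 2)%N,
      weight al + weight be == weight mu,
      nth 0%N al 1 + nth 0%N be 1 <= nth 0%N mu 1,
      nth 0%N mu 1 <= nth 0%N al 1 + nth 0%N be 0 &
      nth 0%N mu 1 <= nth 0%N al 0 + nth 0%N be 1]%N.

Lemma LRcoefC al be : LRcoef al be = LRcoef be al.
Proof.
rewrite /LRcoef; congr xget; apply/predeqP => c /=.
by split=> -[c_fin cE]; split=> // n; rewrite mulrC cE.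
Qed.

Lemma LRcoefP al be : schur_expansion al be (LRcoef al be).
Proof. by rewrite /LRcoef; apply: xgetPex; apply: exists_schur_expansion. Qed.

Lemma LRcoef_two_row al be mu :
  (size mu <= 2)%N -> LRcoef al be mu = (two_row_LR al be mu)%:R.
Proof.
move=> le_mu.
have [c_fin] := LRcoefP al be; move/(_ 2%N) => cE.
have [le_al|lt_al] := leqP (size al) 2; last first.
  have -> : two_row_LR al be mu = false by rewrite /two_row_LR leqNgt lt_al.
  rewrite (coef_schur2 (P := 0) c_fin _ le_mu) ?mcoeff0 // -cE.
  by rewrite tofrac0 mul0r {1}/schur leqNgt lt_al mul0r.
have [le_be|lt_be] := leqP (size be) 2; last first.
  have -> : two_row_LR al be mu = false.
    by rewrite /two_row_LR [(size be <= 2)%N]leqNgt lt_be andbF.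
  rewrite (coef_schur2 (P := 0) c_fin _ le_mu) ?mcoeff0 // -cE.
  by rewrite tofrac0 mul0r {2}/schur leqNgt lt_be mulr0.
(* after exchanging [al] and [be] if necessary, all pairs on the right of
   [alt2M] are weakly decreasing *)
wlog le_diff : al be c_fin cE le_al le_be /
  (nth 0%N be 0 + nth 0%N al 1 <= nth 0%N al 0 + nth 0%N be 1)%N.
  move=> th; have [le_diff|lt_diff] :=
    leqP (nth 0%N be 0 + nth 0%N al 1) (nth 0%N al 0 + nth 0%N be 1); first exact: th.
  have [c_fin' /(_ 2%N) cE'] := LRcoefP be al.
  rewrite LRcoefC th //; last by lia.
  by congr (nat_of_bool _)%:R; rewrite /two_row_LR; lia.
have le1 := part_mono al (leqnSn 0); have le2 := part_mono be (leqnSn 0).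
have le3 := part_mono mu (leqnSn 0).
set p1 := nth 0%N al 0 in le_diff le1 *; set p2 := nth 0%N al 1 in le_diff le1 *.
set q1 := nth 0%N be 0 in le_diff le2 *; set q2 := nth 0%N be 1 in le_diff le2 *.
pose P := \sum_(j < (q1 - q2).+1) alt2 (p1 + q1 - j) (p2 + q2 + j).
rewrite (@coef_schur2 _ P mu) //; last first.
  rewrite -cE /schur le_al le_be mulrACA -tofracM !alternant2E alt2M // tofracM.
  rewrite [nth _ [::] _]nth_nil [nth _ [::] _]nth_nil.
  rewrite mulrACA mulfV ?mul1r // tofrac_eq0.
  by have := alternant2_neq0; rewrite alternant2E !nth_nil.
pose nu (j : 'I_(q1 - q2).+1) := partition_of [:: p1 + q1 - j; p2 + q2 + j]%N.
have nth_nu j i : nth 0%N (nu j) i = nth 0%N [:: p1 + q1 - j; p2 + q2 + j]%N i.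
  by rewrite nth_partition_of //= andbT; have := ltn_ord j; lia.
have le_nu j : (size (nu j) <= 2)%N by apply: size_partition_of.
have coefE (j : 'I_(q1 - q2).+1) : true ->
    (alt2 (p1 + q1 - j) (p2 + q2 + j))@_(lead2 mu) = (nu j == mu)%:R.
  by move=> _; rewrite -mcoeff_alternant2 // alternant2E !nth_nu.
rewrite raddf_sum /= (eq_bigr _ coefE).
have nuE j : (nu j == mu) =
    (p1 + q1 - j == nth 0%N mu 0)%N && (p2 + q2 + j == nth 0%N mu 1)%N.
  apply/eqP/andP => [<-|[/eqP eq0 /eqP eq1]]; first by rewrite !nth_nu.
  by apply: two_row_ext => //; rewrite nth_nu.
have LRE : two_row_LR al be mu =
  [&& (p1 + q1 + p2 + q2 == nth 0%N mu 0 + nth 0%N mu 1)%N,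
    (p2 + q2 <= nth 0%N mu 1)%N & (nth 0%N mu 1 <= p2 + q1)%N].
  by rewrite /two_row_LR le_al le_be le_mu !weight2E //= -/p1 -/p2 -/q1 -/q2; lia.
rewrite LRE; case: and3P => [[/eqP weight_eq le_low le_up]|no_LR]; last first.
  rewrite big1 // => j _; rewrite nuE; case: andP => // -[/eqP eq0 /eqP eq1].
  by case: no_LR; have := ltn_ord j; split; lia.
(* [mu] is the term of index [mu_2 - (p2 + q2)] *)
have lt_j : (nth 0%N mu 1 - (p2 + q2) < (q1 - q2).+1)%N by lia.
rewrite (bigD1 (Ordinal lt_j)) //= nuE /= big1 ?addr0 => [|j neq_j].
  by case: andP => // -[]; split; lia.
rewrite nuE; case: andP => // -[_ /eqP eq1].
by case/eqP: neq_j; apply: val_inj => /=; lia.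
Qed.

(** * Newell-Littlewood numbers of two-row partitions *)

(** The term of [N_{mu, nu, la}] at [(al, be, ga)] does not vanish, where
    [mu], [nu], [la] have at most two parts. *)
Definition two_row_NL (al be ga mu nu la : intpartn) : bool :=
  [&& two_row_LR al be mu, two_row_LR al ga nu & two_row_LR be ga la].

Lemma LRcoef3_two_row al be ga mu nu la :
  (size mu <= 2)%N -> (size nu <= 2)%N -> (size la <= 2)%N ->
  LRcoef al be mu * LRcoef al ga nu * LRcoef be ga la =
  (two_row_NL al be ga mu nu la)%:R.
Proof.
move=> le_mu le_nu le_la; rewrite !LRcoef_two_row // -!natrM !mulnb.
by rewrite -andbA.
Qed.

Lemma finite_two_row (m : nat) :
  finite_set [set la : intpartn | (size la <= 2)%N && (weight la <= m)%N]%classic.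
Proof.
pose s := [seq partition_of [:: p; q] | p <- iota 0 m.+1, q <- iota 0 m.+1].
apply: (@sub_finite_set _ _ [set` s]); last exact: finite_seq.
move=> la /= /andP[le_la]; rewrite weight2E // => le_m.
apply/allpairsP; exists (nth 0%N la 0, nth 0%N la 1).
have le_parts := part_mono la (leqnSn 0).
split; [by rewrite mem_iota /=; lia..|].
apply: two_row_ext; rewrite ?size_partition_of //.
  by rewrite nth_partition_of //= le_parts.
by rewrite nth_partition_of //= le_parts.
Qed.

Lemma NLnumber_two_row_gt0 mu nu la :
  (size mu <= 2)%N -> (size nu <= 2)%N -> (size la <= 2)%N ->
  0 < NLnumber mu nu la <-> exists al be ga, two_row_NL al be ga mu nu la.
Proof.
move=> le_mu le_nu le_la; pose F (t : intpartn * intpartn * intpartn) : int :=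
  (two_row_NL t.1.1 t.1.2 t.2 mu nu la)%:R.
have -> : NLnumber mu nu la = \sum_(t \in [set: intpartn * intpartn * intpartn]) F t.
  by apply: eq_fsbigr => -[[al be] ga] _; apply: LRcoef3_two_row.
split=> [F_gt0|[al [be [ga NL]]]].
  apply: contrapT => no_NL; move: F_gt0; rewrite fsbig1 ?ltxx // => -[[al be] ga] _.
  rewrite /F /=; case: (boolP (two_row_NL _ _ _ _ _ _)) => // NL.
  by case: no_NL; exists al, be, ga.
pose m := (weight mu + weight la)%N.
pose D := [set la : intpartn | (size la <= 2)%N && (weight la <= m)%N]%classic.
have D_fin : finite_set D by apply: finite_two_row.
rewrite fsbig_supp (@fsbigD1 _ _ _ _ (al, be, ga)) /=.
- rewrite {1}/F /= NL; apply: ltr_pwDl => //.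
  by apply: fsumr_ge0 => t _; apply: ler0n.
- apply: (@sub_finite_set _ _ ((D `*` D) `*` D)%classic); last first.
    by apply: finite_setX => //; apply: finite_setX.
  move=> [[al' be'] ga'] /= [_]; rewrite /F /=.
  case: (boolP (two_row_NL _ _ _ _ _ _)) => // /and3P[/and5P[le_al le_be _ /eqP w1 _]].
  move=> /and5P[_ le_ga _ _ _] /and5P[_ _ _ /eqP w2 _] _.
  by rewrite /D /m; split; [split|]; rewrite /= ?le_al ?le_be ?le_ga /=; lia.
- by split=> //; rewrite /F /= NL.
Qed.

(** * Saturation *)

Lemma nth_scale k la i :
  (0 < k)%N -> nth 0%N (scale k la) i = (k * nth 0%N la i)%N.
Proof.
move=> k_gt0; rewrite /= /scale_parts k_gt0 filter_predT.
have [lt_i|le_i] := ltnP i (size la); first by rewrite (nth_map 0%N).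
by rewrite !nth_default ?size_map // muln0.
Qed.

Lemma size_scale k la : (0 < k)%N -> size (scale k la) = size la.
Proof. by move=> k_gt0; rewrite /= /scale_parts k_gt0 filter_predT size_map. Qed.

Lemma weight_scale k la : (0 < k)%N -> weight (scale k la) = (k * weight la)%N.
Proof.
move=> k_gt0; rewrite (@weightE (size la)) ?size_scale // (weightE (leqnn _)).
by rewrite big_distrr /=; apply: eq_bigr => i _; rewrite nth_scale.
Qed.

Lemma two_row_LR_scale k al be mu : (0 < k)%N ->
  two_row_LR (scale k al) (scale k be) (scale k mu) = two_row_LR al be mu.
Proof.
move=> k_gt0; rewrite /two_row_LR !size_scale // !weight_scale // !nth_scale //.
by rewrite -!mulnDr eqn_pmul2l // !leq_pmul2l.
Qed.

(** The two-row partition of weight [weight la / k] with second part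
    [la_2 / k], both rounded down. *)
Definition shrink (k : nat) la : intpartn :=
  partition_of [:: weight la %/ k - nth 0%N la 1 %/ k; nth 0%N la 1 %/ k]%N.

Lemma nth_shrink k la i : (0 < k)%N -> (size la <= 2)%N ->
  nth 0%N (shrink k la) i =
  nth 0%N [:: weight la %/ k - nth 0%N la 1 %/ k; nth 0%N la 1 %/ k]%N i.
Proof.
move=> k_gt0 le_la; rewrite nth_partition_of //= andbT.
suff : (nth 0%N la 1 %/ k + nth 0%N la 1 %/ k <= weight la %/ k)%N by lia.
have := part_mono la (leqnSn 0); rewrite (weight2E le_la) leq_divRL // mulnDl.
by have := leq_trunc_div (nth 0%N la 1) k; lia.
Qed.

Lemma size_shrink k la : (size (shrink k la) <= 2)%N.
Proof. exact: size_partition_of. Qed.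

(** Rounding down preserves the inequalities that bound the difference of two
    unknowns by an integer. *)
Lemma leq_div_offset k p q a b : (0 < k)%N ->
  (q + k * a <= p + k * b)%N -> (q %/ k + a <= p %/ k + b)%N.
Proof.
move=> k_gt0 /(leq_div2r k); rewrite ![(k * _)%N]mulnC.
by rewrite !divnDMl.
Qed.

(** Each bound on the difference of the two second parts is obtained from a
    bound on [mu_2] by expressing a first part through the weight. *)
Lemma two_row_LR_shrink k al be mu : (0 < k)%N ->
  (k %| weight al)%N -> (k %| weight be)%N -> two_row_LR al be (scale k mu) ->
  two_row_LR (shrink k al) (shrink k be) mu.
Proof.
move=> k_gt0 /dvdnP[A wA] /dvdnP[B wB] /and5P[le_al le_be].
rewrite size_scale // weight_scale // => le_mu /eqP wE.
rewrite !nth_scale // => /and3P[le1 le2 le3].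
have /eqP wAB : (A + B == weight mu)%N.
  by rewrite -(eqn_pmul2l k_gt0) -wE wA wB mulnDr; lia.
rewrite /two_row_LR !size_shrink le_mu !(weight2E (size_shrink _ _)) !nth_shrink //=.
rewrite wA wB !mulnK //.
rewrite !weight2E // in wA wB.
have mono_al := part_mono al (leqnSn 0); have mono_be := part_mono be (leqnSn 0).
set p := nth 0%N al 1 in le1 le2 le3 wA mono_al *.
set q := nth 0%N be 1 in le1 le2 le3 wB mono_be *.
have le_sum : (p %/ k + q %/ k <= nth 0%N mu 1)%N.
  rewrite -(leq_pmul2l k_gt0) mulnDr.
  by have := leq_trunc_div p k; have := leq_trunc_div q k; lia.
have le_qp : (q %/ k + nth 0%N mu 1 <= p %/ k + B)%N.
  by apply: leq_div_offset => //; rewrite [(k * B)%N]mulnC; lia.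
have le_pq : (p %/ k + nth 0%N mu 1 <= q %/ k + A)%N.
  by apply: leq_div_offset => //; rewrite [(k * A)%N]mulnC; lia.
have le_p : (p %/ k <= A)%N.
  by rewrite -[A](mulnK _ k_gt0) leq_div2r //; lia.
have le_q : (q %/ k <= B)%N.
  by rewrite -[B](mulnK _ k_gt0) leq_div2r //; lia.
lia.
Qed.

(** The weights of [al], [be], [ga] are forced: twice each of them is a signed
    sum of the weights of [mu], [nu] and [la]. This is where parity enters. *)
Lemma two_row_NL_shrink k al be ga mu nu la : (0 < k)%N ->
  ~~ odd (weight la + weight mu + weight nu)%N ->
  two_row_NL al be ga (scale k mu) (scale k nu) (scale k la) ->
  two_row_NL (shrink k al) (shrink k be) (shrink k ga) mu nu la.
Proof.
move=> k_gt0 even_w /and3P[LRmu LRnu LRla].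
have weightE' a b c : two_row_LR a b (scale k c) ->
    (weight a + weight b = k * weight c)%N.
  by case/and5P=> _ _ _ /eqP; rewrite weight_scale.
have := weightE' _ _ _ LRmu; have := weightE' _ _ _ LRnu.
have := weightE' _ _ _ LRla => w_la w_nu w_mu.
pose W := ((weight la + weight mu + weight nu)./2)%N.
have WE : (weight la + weight mu + weight nu = W + W)%N.
  by rewrite addnn /W even_halfK.
have kWE : (k * weight la + k * weight mu + k * weight nu = k * W + k * W)%N.
  by rewrite -!mulnDr WE.
have dvd a c : (weight a + k * weight c = k * W)%N -> (k %| weight a)%N.
  move=> aE; rewrite -(@dvdn_addl (k * weight c)) ?dvdn_mulr //.
  by rewrite aE dvdn_mulr.
have dvd_al : (k %| weight al)%N by apply: (dvd al la); lia.
have dvd_be : (k %| weight be)%N by apply: (dvd be nu); lia.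
have dvd_ga : (k %| weight ga)%N by apply: (dvd ga mu); lia.
by apply/and3P; split; apply: two_row_LR_shrink.
Qed.

Theorem corollary5p15 (la mu nu : intpartn)
    (size_la : (size la <= 2)%N) (size_mu : (size mu <= 2)%N)
    (size_nu : (size nu <= 2)%N)
    (even_weight : (weight la + weight mu + weight nu = 0 %[mod 2])%N)
    (k : nat) (k_ge1 : (1 <= k)%N)
    (NL_gt0 : 0 < NLnumber (scale k mu) (scale k nu) (scale k la)) :
  0 < NLnumber mu nu la /\
  exists al be ga : intpartn,
    0 < LRcoef (scale k al) (scale k be) (scale k mu)
        * LRcoef (scale k al) (scale k ga) (scale k nu)
        * LRcoef (scale k be) (scale k ga) (scale k la).
Proof.
have even_w : ~~ odd (weight la + weight mu + weight nu).
  by move: even_weight; rewrite modn2 mod0n; case: (odd _).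
have [] := iffLR (NLnumber_two_row_gt0 _ _ _) NL_gt0; rewrite ?size_scale //.
move=> al' [be' [ga' /(two_row_NL_shrink k_ge1 even_w)]].
set al := shrink k al'; set be := shrink k be'; set ga := shrink k ga' => NL.
split; first by apply/NLnumber_two_row_gt0 => //; exists al, be, ga.
exists al, be, ga; rewrite LRcoef3_two_row ?size_scale //.
by rewrite /two_row_NL !two_row_LR_scale // -/(two_row_NL al be ga mu nu la) NL.
Qed.
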